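(* Let $(X,d)$ be a nonempty complete metric space and let $\mathcal{F}=\{w_1,\dots,w_N\}$ be an IFS on $X$ all of whose maps $w_i:X\to X$ are Browder contractions [respectively: all Banach contractions; all Rakotch contractions; all Matkowski contractions]. Then the Hutchinson operator $\mathcal{F}:(\mathcal{K}(X),d_H)\to(\mathcal{K}(X),d_H)$ is a Browder contraction [respectively: a Banach contraction; a Rakotch contraction; a Matkowski contraction], and hence it has a contractive fixed point; that is, there is a unique nonempty compact set $A_{\mathcal{F}}\subseteq X$ with $\mathcal{F}(A_{\mathcal{F}})=A_{\mathcal{F}}$, and for every $K\in\mathcal{K}(X)$ the iterates $\mathcal{F}^k(K)$ converge to $A_{\mathcal{F}}$ with respect to $d_H$.
   Context: An IFS (iterated function system) is a finite family $\mathcal{F}=\{w_1,\dots,w_N\}$, $N\ge 1$, of maps $w_i:X\to X$. $\mathcal{K}(X)$ is the set of nonempty compact subsets of $X$ and $d_H$ is the Hausdorff metric on it. For continuous $w_i$ the Hutchinson operator on $\mathcal{K}(X)$ is $\mathcal{F}(K)=\bigcup_{i=1}^N w_i(K)$. Let $\mathbb{R}_+=[0,\infty)$ and $\varphi:\mathbb{R}_+\to\mathbb{R}_+$. A selfmap $f$ of a metric space $(Y,\rho)$ is a $\varphi$-contraction if $\rho(f(x),f(y))\le\varphi(\rho(x,y))$ for all $x,y\in Y$. The map $f$ is: a Banach contraction if its Lipschitz constant is $<1$; a Rakotch contraction if it is a $\varphi$-contraction for some $\varphi(t)=\lambda(t)t$ with $\lambda:\mathbb{R}_+\to[0,1]$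 nonincreasing and $\lambda(t)<1$ for $t>0$; a Browder contraction if it is a $\varphi$-contraction for some nondecreasing right continuous $\varphi$ with $\varphi(t)<t$ for $t>0$; a Matkowski contraction if it is a $\varphi$-contraction for some nondecreasing $\varphi$ with $\lim_{k\to\infty}\varphi^k(t)=0$ for every $t>0$ ($\varphi^k$ is the $k$-fold composition). A contractive fixed point of $f:Y\to Y$ is a point $x_*$ with $f(x_* )=x_*$ and $f^k(x)\to x_*$ for every $x\in Y$. *)

(* Defs.v *)
From HB Require Import structures.
From mathcomp Require Import all_boot all_order all_algebra.
From mathcomp Require Import all_classical all_reals all_analysis.

Set Implicit Arguments.
Unset Strict Implicit.
Unset Printing Implicit Defensive.

Import Order.TTheory GRing.Theory Num.Theory.
Import numFieldNormedType.Exports.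

Local Open Scope classical_set_scope.
Local Open Scope ring_scope.

(* The library's completeType extends pointedType, so that the inhabitants of
   completeMetricType R are exactly the nonempty complete metric spaces. *)
#[short(type="completeMetricType")]
HB.structure Definition CompleteMetric (R : numDomainType) :=
  {T of Complete T & Metric R T}.

Record compacts (X : topologicalType) := Compacts {
  compact_set : set X;
  _ : `[< compact_set !=set0 /\ compact compact_set >]
}.

HB.instance Definition _ (X : topologicalType) := [isSub for @compact_set X].
HB.instance Definition _ (X : topologicalType) :=
  [Choice of compacts X by <:].

Lemma compacts_nonempty (X : topologicalType) (K : compacts X) :
  compact_set K !=set0.
Proof. by case: K => K /= /asboolP[]. Qed.

Lemma compacts_compact (X : topologicalType) (K : compacts X) :
  compact (compact_set K).
Proof. by case: K => K /= /asboolP[]. Qed.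

Section hausdorff_distance.
Context {R : realType} {X : metricType R}.
Implicit Types (x y : X) (A B C : set X) (K L M : compacts X).

Definition dist_to A x : R := inf [set mdist x a | a in A].

(* sup and inf are real-valued: the suprema below are genuine ones because
   compact sets are bounded (dist_to_le_excess). *)
Definition excess A B : R := sup [set dist_to B a | a in A].

Definition hausdorff_dist K L : R :=
  Num.max (excess (compact_set K) (compact_set L))
          (excess (compact_set L) (compact_set K)).

Lemma dist_to_le A x a : A a -> dist_to A x <= mdist x a.
Proof.
move=> Aa; apply: ge_inf; last by exists a.
by exists 0 => _ [b _ <-]; exact: mdist_ge0.
Qed.

Lemma dist_to_ge A x r : A !=set0 -> (forall a, A a -> r <= mdist x a) ->
  r <= dist_to A x.
Proof.
move=> [a Aa] rA; apply: lb_le_inf; first by exists (mdist x a), a.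
by move=> _ [b Ab <-]; exact: rA.
Qed.

Lemma dist_to_ge0 A x : A !=set0 -> 0 <= dist_to A x.
Proof. by move=> A0; apply: dist_to_ge => // a _; exact: mdist_ge0. Qed.

Lemma dist_to_lt A x e : A !=set0 -> dist_to A x < e ->
  exists2 a, A a & mdist x a < e.
Proof.
move=> [a Aa] xe; have A0 : [set mdist x a | a in A] !=set0 by exists (mdist x a), a.
by have [_ [b Ab <-]] := inf_lt A0 xe; exists b.
Qed.

Lemma compact_bounded_dist A x : compact A ->
  exists r : R, forall a, A a -> mdist x a <= r.
Proof.
move=> /compact_near_coveringP.
move=> /(_ R +oo (fun r y => mdist x y <= r) _) xA.
suff /xA/filter_ex[r rA] : forall y, A y ->
    \forall y' \near y & r \near +oo, mdist x y' <= r by exists r.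
move=> y Ay; near=> y' r => /=.
apply: (@le_trans _ _ (mdist x y + 1)); last by near: r; apply: nbhs_pinfty_ge; rewrite num_real.
rewrite (le_trans (metric_triangle _ y _))// lerD2l ltW//.
have : ball y 1 y' by near: y'; exact: nbhsx_ballx.
by rewrite ballEmdist.
Unshelve. all: by end_near. Qed.

Lemma dist_to_le_excess K L x : compact_set K x ->
  dist_to (compact_set L) x <= excess (compact_set K) (compact_set L).
Proof.
move=> Kx; apply: ub_le_sup; last by exists x.
have [b Lb] := compacts_nonempty L.
have [r rK] := compact_bounded_dist b (@compacts_compact _ K).
exists r => _ [a Ka <-]; apply: le_trans (rK _ Ka).
by rewrite metric_sym; exact: dist_to_le.
Qed.

Lemma excess_le A B r : A !=set0 -> (forall a, A a -> dist_to B a <= r) ->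
  excess A B <= r.
Proof.
move=> [a Aa] Ar; apply: ge_sup; first by exists (dist_to B a), a.
by move=> _ [b Ab <-]; exact: Ar.
Qed.

Lemma excess_ge0 K L : 0 <= excess (compact_set K) (compact_set L).
Proof.
have [x Kx] := compacts_nonempty K.
apply: le_trans (dist_to_le_excess L Kx).
exact/dist_to_ge0/compacts_nonempty.
Qed.

Lemma excess_triangle K L M : excess (compact_set K) (compact_set M) <=
  excess (compact_set K) (compact_set L) +
  excess (compact_set L) (compact_set M).
Proof.
apply: excess_le => [|x Kx]; first exact: compacts_nonempty.
rewrite -lerBlDr; apply: le_trans (dist_to_le_excess L Kx).
apply: dist_to_ge => [|y Ly]; first exact: compacts_nonempty.
rewrite lerBlDr -lerBlDl; apply: le_trans (dist_to_le_excess M Ly).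
apply: dist_to_ge => [|z Mz]; first exact: compacts_nonempty.
by rewrite lerBlDl (le_trans (dist_to_le _ Mz))// metric_triangle.
Qed.

Lemma excess_eq0 K L : excess (compact_set K) (compact_set L) <= 0 ->
  compact_set K `<=` compact_set L.
Proof.
move=> KL x Kx.
have clL : closed (compact_set L).
  by apply: compact_closed (@compacts_compact _ L); exact: metric_hausdorff.
apply: clL => B /nbhs_ballP[e /= e0 eB].
have xe : dist_to (compact_set L) x < e.
  by rewrite (le_lt_trans (dist_to_le_excess L Kx))// (le_lt_trans KL).
have [y Ly xy] := dist_to_lt (compacts_nonempty L) xe.
by exists y; split => //; apply: eB; rewrite ballEmdist.
Qed.

Lemma hausdorff_distxx K : hausdorff_dist K K = 0.
Proof.
rewrite /hausdorff_dist maxxx; apply/eqP; rewrite eq_le excess_ge0 andbT.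
apply: excess_le => [|x Kx]; first exact: compacts_nonempty.
by rewrite (le_trans (dist_to_le _ Kx))// mdistxx.
Qed.

Lemma hausdorff_dist_positivity K L : hausdorff_dist K L = 0 -> K = L.
Proof.
move=> KL; apply: val_inj; have : hausdorff_dist K L <= 0 by rewrite KL.
by rewrite ge_max => /andP[? ?]; apply/seteqP; split; exact: excess_eq0.
Qed.

Lemma hausdorff_dist_sym K L : hausdorff_dist K L = hausdorff_dist L K.
Proof. by rewrite /hausdorff_dist maxC. Qed.

Lemma hausdorff_dist_triangle L K M :
  hausdorff_dist K M <= hausdorff_dist K L + hausdorff_dist L M.
Proof.
rewrite /hausdorff_dist ge_max; apply/andP; split.
  by rewrite (le_trans (excess_triangle K L M))// lerD// le_max lexx.
rewrite (le_trans (excess_triangle M L K))// addrC.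
by rewrite lerD// le_max lexx orbT.
Qed.

End hausdorff_distance.

HB.instance Definition _ (R : realType) (X : metricType R) :=
  @isMetric.Build R (compacts X) (@hausdorff_dist R X) (@hausdorff_distxx R X)
    (@hausdorff_dist_positivity R X) (@hausdorff_dist_sym R X)
    (@hausdorff_dist_triangle R X).

Section contractions.
Context {R : realType}.
Implicit Type Y : metricType R.

(* Functions from R_+ to R_+ are represented by functions on R, of which only
   the values on [0, +oo[ are constrained. *)
Definition nonneg_fun (phi : R -> R) := forall t, 0 <= t -> 0 <= phi t.

Definition nondecreasing_on_nonneg (phi : R -> R) :=
  forall s t, 0 <= s -> s <= t -> phi s <= phi t.

Definition phi_contraction (phi : R -> R) Y (f : Y -> Y) :=
  nonneg_fun phi /\ forall x y, mdist (f x) (f y) <= phi (mdist x y).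

Definition lipschitz_constant Y (f : Y -> Y) : \bar R :=
  ereal_inf [set L%:E | L in
    [set L : R | 0 <= L /\ forall x y, mdist (f x) (f y) <= L * mdist x y]].

Definition banach_contraction Y (f : Y -> Y) :=
  (lipschitz_constant f < 1%:E)%E.

Definition rakotch_contraction Y (f : Y -> Y) :=
  exists lambda : R -> R,
    [/\ forall t, 0 <= t -> 0 <= lambda t <= 1,
        forall s t, 0 <= s -> s <= t -> lambda t <= lambda s,
        forall t, 0 < t -> lambda t < 1 &
        phi_contraction (fun t => lambda t * t) f].

Definition browder_contraction Y (f : Y -> Y) :=
  exists phi : R -> R,
    [/\ nondecreasing_on_nonneg phi,
        forall t, 0 <= t -> phi s @[s --> t^'+] --> phi t,
        forall t, 0 < t -> phi t < t &
        phi_contraction phi f].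

Definition matkowski_contraction Y (f : Y -> Y) :=
  exists phi : R -> R,
    [/\ nondecreasing_on_nonneg phi,
        forall t, 0 < t -> iter k phi t @[k --> \oo] --> (0 : R) &
        phi_contraction phi f].

Inductive contraction_kind := Banach | Rakotch | Browder | Matkowski.

Definition contraction_of (kind : contraction_kind) Y (f : Y -> Y) : Prop :=
  match kind with
  | Banach => banach_contraction f
  | Rakotch => rakotch_contraction f
  | Browder => browder_contraction f
  | Matkowski => matkowski_contraction f
  end.

Definition contractive_fixed_point Y (f : Y -> Y) (p : Y) :=
  f p = p /\ forall x : Y, iter k f x @[k --> \oo] --> p.

End contractions.

(* An IFS with N >= 1 maps is indexed by 'I_N'.+1, where N = N'.+1. *)
Definition hutchinson_set (T : Type) (N' : nat) (w : 'I_N'.+1 -> T -> T)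
  (A : set T) : set T := \bigcup_(i in [set: 'I_N'.+1]) (w i @` A).

Lemma hutchinson_subproof (X : topologicalType) (N' : nat)
    (w : 'I_N'.+1 -> X -> X) (wc : forall i, continuous (w i))
    (K : compacts X) :
  `[< hutchinson_set w (compact_set K) !=set0 /\
      compact (hutchinson_set w (compact_set K)) >].
Proof.
apply/asboolP; split.
  by have [x Kx] := compacts_nonempty K; exists (w ord0 x), ord0 => //; exists x.
rewrite /hutchinson_set.
have -> : \bigcup_(i in [set: 'I_N'.+1]) (w i @` compact_set K) =
    \big[setU/set0]_(i <- index_enum 'I_N'.+1) (w i @` compact_set K).
  rewrite -bigcup_seq; apply: eq_bigcupl.
  by split => i _ //=; rewrite mem_index_enum.
apply: bigsetU_compact => i _; apply: continuous_compact.
  exact/continuous_subspaceT/wc.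
exact: compacts_compact.
Qed.

Definition hutchinson (X : topologicalType) (N' : nat)
    (w : 'I_N'.+1 -> X -> X) (wc : forall i, continuous (w i))
    (K : compacts X) : compacts X :=
  Compacts (hutchinson_subproof wc K).

(* Main.v *)
(* The nearest-point property of compact sets turns a bound r on all
   d(w_i x, w_i y) with d(x, y) <= d_H(K, L) into d_H(F K, F L) <= r, so that F
   is a contraction for the maximum of the comparison functions of the w_i.
   For Matkowski functions phi_i the iterates of max_i phi_i still vanish: among
   N * M steps some phi_i is used at least M times, and the other steps do not
   increase the value.

   Every kind of contraction satisfies a weak Meir-Keeler condition (distances
   slightly above e are mapped to distances at most e) and makes any two orbits
   asymptotic. These two properties force every orbit to be Cauchy, and K(X) is
   complete: the limit of a Cauchy sequence K_n is the intersection of the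
   closures of its tails, which is compact because an ultrafilter staying near
   compact sets at every scale is Cauchy. *)
Require Import Defs.
From HB Require Import structures.
From mathcomp Require Import all_boot all_order all_algebra.
From mathcomp Require Import all_classical all_reals all_analysis.
From mathcomp Require Import lra.

Set Implicit Arguments.
Unset Strict Implicit.
Unset Printing Implicit Defensive.

Import Order.TTheory GRing.Theory Num.Theory.
Import numFieldNormedType.Exports.

Local Open Scope classical_set_scope.
Local Open Scope ring_scope.

(** * Meir-Keeler conditions and contractive fixed points *)

Section fixed_points.
Context {R : realType} {Y : metricType R}.
Implicit Types (f : Y -> Y) (x y : Y).

Definition meir_keeler f := forall e : R, 0 < e -> exists2 d : R, 0 < d &
  forall x y, mdist x y < e + d -> mdist (f x) (f y) < e.

(** The non-strict conclusion accommodates Matkowski contractions: without right continuity, [phi]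
    may equal [e] just to the right of [e]. *)
Definition weak_meir_keeler f := forall e : R, 0 < e -> exists2 d : R, 0 < d &
  forall x y, mdist x y < e + d -> mdist (f x) (f y) <= e.

Definition orbits_asymptotic f := forall x y,
  mdist (iter k f x) (iter k f y) @[k --> \oo] --> (0 : R).

Lemma meir_keelerW f : meir_keeler f -> weak_meir_keeler f.
Proof.
by move=> fMK e /fMK[d d0 fd]; exists d => // x y /fd/ltW.
Qed.

Lemma weak_meir_keeler_le f : weak_meir_keeler f ->
  forall x y, mdist (f x) (f y) <= mdist x y.
Proof.
move=> fMK x y; have [->|xy] := eqVneq x y; first by rewrite !mdistxx.
have [|d d0 fd] := fMK (mdist x y); first by rewrite mdist_gt0.
by apply: fd; rewrite ltrDl.
Qed.

Lemma cvg_mdistP T (F : set_system T) (FF : Filter F) (u : T -> Y) l :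
  (u @ F --> l) <-> forall e, 0 < e -> \forall k \near F, mdist l (u k) < e.
Proof.
by split=> [/cvg_ballP ul e /ul|ul]; [|apply/cvg_ballP => e /ul];
  apply: filterS => k; rewrite ballEmdist.
Qed.

Lemma weak_meir_keeler_continuous f : weak_meir_keeler f -> continuous f.
Proof.
move=> fMK x; apply/cvg_mdistP => e e0.
apply/nbhs_ballP; exists e => //= y; rewrite ballEmdist/=.
by apply: le_lt_trans; exact: weak_meir_keeler_le.
Qed.

(** The distances decrease to their infimum; were it positive, the strict condition at that infimum
    would push some later distance below it. *)
Lemma meir_keeler_asymptotic f : meir_keeler f -> orbits_asymptotic f.
Proof.
move=> fMK x y; pose a k := mdist (iter k f x) (iter k f y).
have a_ni : nonincreasing_seq a.
  apply/nonincreasing_seqP => k.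
  exact: (weak_meir_keeler_le (meir_keelerW fMK)).
have a_lb : has_lbound (range a) by exists 0 => _ [k _ <-]; exact: mdist_ge0.
have al := nonincreasing_cvgn a_ni a_lb.
suff <- : inf (range a) = 0 by [].
apply/eqP; rewrite eq_le [X in _ && X]lb_le_inf ?andbT; last 2 first.
- by exists (a 0%N), 0%N.
- by move=> _ [k _ <-]; exact: mdist_ge0.
rewrite leNgt; apply/negP => /[dup] l0 /fMK[d d0 fd].
have : \forall k \near \oo, a k < inf (range a) + d.
  by apply: (cvgr_lt _ al); rewrite ltrDl.
case=> k _ /(_ k (leqnn k))/fd; rewrite ltNge => /negP; apply.
by apply: ge_inf => //; exists k.+1.
Qed.

Lemma contractive_fixed_point_unique f p q :
  contractive_fixed_point f p -> f q = q -> q = p.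
Proof.
move=> [_ /(_ q) qp] fq; apply: (@cvg_unique _ (metric_hausdorff (T := Y)) _ _ _ _ _ qp).
rewrite (_ : (fun k => _) = fun=> q); first exact: cvg_cst.
by apply/funext; elim=> //= k ->.
Qed.

(** Once one step of the orbit is short, a small ball around the current point traps the rest of the
    orbit, which is therefore Cauchy. *)
Lemma contractive_fixed_point_exists f (x0 : Y) :
  (forall u : nat -> Y, cauchy_ex (u @ \oo) -> exists l : Y, u @ \oo --> l) ->
  weak_meir_keeler f -> orbits_asymptotic f ->
  exists p, contractive_fixed_point f p.
Proof.
move=> complY fMK fas; pose u k := iter k f x0.
have [e e0|p up] := complY u.
  have e20 : 0 < e / 2 by rewrite divr_gt0.
  have [d d0 fd] := fMK _ e20.
  (* [d' <= d] lets [fd] act on the ball of radius [e / 2 + d'], and [d' <= e / 2] keeps that radius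
     at most [e]. *)
  pose d' := Num.min d (e / 2); have d'0 : 0 < d' by rewrite lt_min d0.
  have := fas x0 (f x0); move=> /(cvgr_lt _)/(_ d' d'0)[k _ /(_ k (leqnn k))].
  rewrite -iterSr => /= ukd; exists (u k); exists k => // n /= kn.
  rewrite ballEmdist /= -(subnKC kn); apply: (@lt_le_trans _ _ (e / 2 + d')).
    (* A point of the trapping ball is mapped within [e / 2] of [u k.+1], which is itself within
       [d'] of [u k]. *)
    elim: (n - k)%N => [|m IH]; first by rewrite addn0 mdistxx addr_gt0.
    rewrite addnS (le_lt_trans (metric_triangle _ (u k.+1) _))// addrC.
    rewrite ler_ltD//; apply: fd; apply: lt_le_trans IH _.
    by rewrite lerD2l ge_min lexx.
  by rewrite [leRHS]splitr lerD2l ge_min lexx orbT.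
have fp : f p = p.
  apply: mdist_positivity; apply/eqP; rewrite eq_le mdist_ge0 andbT.
  apply/ler_addgt0Pr => e e0; rewrite add0r.
  have e20 : 0 < e / 2 by rewrite divr_gt0.
  have [N _ uN] := (cvg_mdistP _ _ _).1 up _ e20.
  rewrite (le_trans (metric_triangle _ (u N.+1) _))// [leRHS]splitr lerD//.
    by apply: (le_trans (weak_meir_keeler_le fMK _ _)); exact/ltW/uN/leqnn.
  by rewrite metric_sym; exact/ltW/uN/leqnSn.
exists p; split=> // x; apply/cvg_mdistP => e e0.
have : \forall k \near \oo, mdist (iter k f p) (iter k f x) < e.
  exact: cvgr_lt (fas p x) _ e0.
by apply: filterS => k; have -> // : iter k f p = p by elim: k => //= k ->.
Qed.

End fixed_points.

(** * Meir-Keeler conditions and asymptotic orbits for the four kinds *)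

Section contraction_kinds.
Context {R : realType} {Y : metricType R}.
Implicit Types (f : Y -> Y) (phi : R -> R).

Lemma banach_contractionP f : banach_contraction f <->
  exists2 L : R, 0 <= L < 1 & forall x y, mdist (f x) (f y) <= L * mdist x y.
Proof.
split=> [/ereal_inf_ltP[_ [L [L0 fL] <-]]|[L /andP[L0 L1] fL]].
  by rewrite lte_fin => L1; exists L => //; rewrite L0.
by apply/ereal_inf_ltP; exists L%:E; [exists L|rewrite lte_fin].
Qed.

Lemma banach_rakotch f : banach_contraction f -> rakotch_contraction f.
Proof.
move=> /banach_contractionP[L /andP[L0 L1] fL]; exists (fun=> L); split => //.
  by move=> t _; rewrite L0 ltW.
by split=> // t t0; rewrite mulr_ge0.
Qed.

Lemma rakotch_meir_keeler f : rakotch_contraction f -> meir_keeler f.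
Proof.
move=> [l [l01 l_ni l1 [_ fl]]] e e0.
have e20 : 0 < e / 2 by rewrite divr_gt0.
have le1 := l1 _ e20; have /andP[le0 _] := l01 _ (ltW e20).
(* Beyond distance [e / 2] the factor is at most [q = l (e / 2)], and [q * (e + (1 - q) * e) = e -
   (1 - q)^2 * e < e]. *)
exists ((1 - l (e / 2)) * e) => [|x y]; first by rewrite mulr_gt0// subr_gt0.
move=> xy; apply: le_lt_trans (fl x y) _.
have /andP[lt0 lt1] := l01 _ (mdist_ge0 x y).
have [xye|exy] := leP (mdist x y) (e / 2).
  rewrite (@le_lt_trans _ _ (mdist x y)) ?ler_piMl ?mdist_ge0//.
  by rewrite (le_lt_trans xye)// gtr_pMr// invf_lt1// ltr1n.
apply: (@le_lt_trans _ _ (l (e / 2) * mdist x y)).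
  by rewrite ler_wpM2r ?mdist_ge0// l_ni// ltW.
apply: (@le_lt_trans _ _ (l (e / 2) * (e + (1 - l (e / 2)) * e))).
  by rewrite ler_wpM2l// ltW.
have : 0 < (1 - l (e / 2)) * (1 - l (e / 2)) * e.
  by rewrite !mulr_gt0// subr_gt0.
by lra.
Qed.

(** Right continuity at [e] turns [phi e < e] into [phi s < e] for some [s > e]; monotonicity
    extends this to all distances below [s]. *)
Lemma browder_meir_keeler f : browder_contraction f -> meir_keeler f.
Proof.
move=> [phi [phi_nd phi_rc phi_lt [_ fphi]]] e e0.
have : \forall s \near e^'+, e < s /\ phi s < e.
  near=> s; split; first by near: s; exact: nbhs_right_gt.
  by near: s; exact: cvgr_lt (phi_rc _ (ltW e0)) _ (phi_lt _ e0).
move=> /filter_ex[s [es phis]]; exists (s - e) => [|x y]; first by rewrite subr_gt0.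
rewrite addrC subrK => xys; apply: le_lt_trans (fphi x y) (le_lt_trans _ phis).
by apply: phi_nd (mdist_ge0 x y) _; exact: ltW.
Unshelve. all: by end_near. Qed.

Lemma iter_gt phi (e t : R) : (forall s, e < s -> e < phi s) -> e < t ->
  forall k, e < iter k phi t.
Proof. by move=> ephi et; elim=> //= k /ephi. Qed.

Lemma iter_ge0 phi t k : nonneg_fun phi -> 0 <= t -> 0 <= iter k phi t.
Proof. by move=> phi0 t0; elim: k => //= k /phi0. Qed.

(** If [t <= phi t], monotonicity keeps every iterate above [t]. *)
Lemma matkowski_lt phi t : nondecreasing_on_nonneg phi ->
  (forall t, 0 < t -> iter k phi t @[k --> \oo] --> (0 : R)) ->
  0 < t -> phi t < t.
Proof.
move=> phi_nd phi0 t0; rewrite ltNge; apply/negP => tphi.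
have [k _ /(_ k (leqnn k))] := cvgr_lt _ (phi0 _ t0) _ t0.
rewrite ltNge => /negP; apply; elim: k => //= k IH.
by rewrite (le_trans tphi)// phi_nd// ltW.
Qed.

(** If the condition fails at [e], then [phi] maps the half-line above [e] into itself, so the
    iterates from [e + 1] cannot vanish. *)
Lemma matkowski_weak_meir_keeler f :
  matkowski_contraction f -> weak_meir_keeler f.
Proof.
move=> [phi [phi_nd phi0 [_ fphi]]] e e0; apply: contrapT => nMK.
have phi_gt s : e < s -> e < phi s.
  move=> es; rewrite ltNge; apply/negP => phis; apply: nMK.
  exists (s - e) => [|x y]; first by rewrite subr_gt0.
  rewrite addrC subrK => /ltW xys; apply: le_trans (fphi x y) _.
  by apply: le_trans phis; exact: phi_nd (mdist_ge0 x y) xys.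
have e1 : 0 < e + 1 by rewrite addr_gt0.
have [k _ /(_ k (leqnn k))] := cvgr_lt _ (phi0 _ e1) _ e0.
by rewrite ltNge => /negP; apply; apply/ltW/iter_gt => //; rewrite ltrDl.
Qed.

Lemma matkowski_asymptotic f : matkowski_contraction f -> orbits_asymptotic f.
Proof.
move=> [phi [phi_nd phi0 [_ fphi]]] x y.
(* The iterates of [phi] are assumed to vanish only from a positive start. *)
have [->|xy] := eqVneq x y.
  by under eq_fun do rewrite mdistxx; exact: cvg_cst.
rewrite -mdist_gt0 in xy.
apply: (squeeze_cvgr _ (cvg_cst (0 : R)) (phi0 _ xy)).
near=> k; rewrite mdist_ge0/=; elim: (k : nat) => //= n IH.
by rewrite (le_trans (fphi _ _))// phi_nd// mdist_ge0.
Unshelve. all: by end_near. Qed.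

Lemma contraction_weak_meir_keeler kind f :
  contraction_of kind f -> weak_meir_keeler f.
Proof.
case: kind => /=.
- by move=> /banach_rakotch/rakotch_meir_keeler/meir_keelerW.
- by move=> /rakotch_meir_keeler/meir_keelerW.
- by move=> /browder_meir_keeler/meir_keelerW.
- exact: matkowski_weak_meir_keeler.
Qed.

Lemma contraction_orbits_asymptotic kind f :
  contraction_of kind f -> orbits_asymptotic f.
Proof.
case: kind => /=.
- by move=> /banach_rakotch/rakotch_meir_keeler/meir_keeler_asymptotic.
- by move=> /rakotch_meir_keeler/meir_keeler_asymptotic.
- by move=> /browder_meir_keeler/meir_keeler_asymptotic.
- exact: matkowski_asymptotic.
Qed.

End contraction_kinds.

(** * Maxima of finitely many comparison functions *)

Section comparison_functions.
Context {R : realType} {N' : nat}.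
Implicit Types (phi : 'I_N'.+1 -> R -> R) (t : R).

Definition max_fun phi t : R := \big[Num.max/0]_i phi i t.

Lemma le_max_fun phi i t : phi i t <= max_fun phi t.
Proof. by rewrite /max_fun (le_bigmax _ (fun i => phi i t)). Qed.

Lemma max_fun_ge0 phi : nonneg_fun (max_fun phi).
Proof. by move=> t _; exact: bigmax_ge_id. Qed.

Lemma max_fun_nondecreasing phi : (forall i, nondecreasing_on_nonneg (phi i)) ->
  nondecreasing_on_nonneg (max_fun phi).
Proof. by move=> phi_nd s t s0 st; apply: le_bigmax2 => i _; exact: phi_nd. Qed.

Lemma max_fun_lt phi t r : 0 < r -> (forall i, phi i t < r) ->
  max_fun phi t < r.
Proof. by move=> r0 phir; apply: bigmax_lt. Qed.

Lemma max_fun_eq phi t : (forall i, 0 <= phi i t) ->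
  exists i, max_fun phi t = phi i t.
Proof.
move=> phi0; have := @eq_bigmax _ _ _ 0 ord0 predT (phi ^~ t) isT.
by move=> /(_ (fun i _ => phi0 i))[i _ phii]; exists i.
Qed.

(** Monotonicity gives the lower estimate; the upper one combines finitely many conditions that hold
    near [t]. *)
Lemma max_fun_right_continuous phi t : 0 <= t ->
  (forall i, nonneg_fun (phi i)) ->
  (forall i, nondecreasing_on_nonneg (phi i)) ->
  (forall i, phi i s @[s --> t^'+] --> phi i t) ->
  max_fun phi s @[s --> t^'+] --> max_fun phi t.
Proof.
move=> t0 phi0 phi_nd phi_rc; apply/cvgrPdist_lt => e e0.
have : \forall s \near t^'+, forall i, phi i s < max_fun phi t + e.
  apply: filter_forall => i; apply: cvgr_lt (phi_rc i) _ _.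
  by rewrite (le_lt_trans (le_max_fun _ _ _))// ltrDl.
apply: filter_app; near=> s => phis.
have ts : t <= s by near: s; exact: nbhs_right_ge.
rewrite distrC ger0_norm ?subr_ge0 ?max_fun_nondecreasing//.
by rewrite ltrBlDl max_fun_lt// ltr_wpDl// max_fun_ge0.
Unshelve. all: by end_near. Qed.

(* Each step of the iteration is made by some [phi i] attaining the maximum;
   [c i] counts the steps made by [phi i]. *)
Lemma iter_max_fun_le phi t k : 0 < t ->
  (forall i, nonneg_fun (phi i)) ->
  (forall i, nondecreasing_on_nonneg (phi i)) ->
  (forall i (s : R), 0 <= s -> phi i s <= s) ->
  exists c : 'I_N'.+1 -> nat, (\sum_i c i)%N = k /\
    forall i, iter k (max_fun phi) t <= iter (c i) (phi i) t.
Proof.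
move=> t0 phi0 phi_nd phi_le; elim: k => [|k [c [ck phic]]].
  by exists (fun=> 0%N); rewrite big1.
set a := iter k (max_fun phi) t in phic *.
have a0 : 0 <= a by apply: iter_ge0 (ltW t0); exact: max_fun_ge0.
have [j phij] := max_fun_eq (fun i => phi0 i _ a0).
exists (fun i => c i + (i == j))%N; split.
  by rewrite big_split/= ck (bigD1 j)//= eqxx big1 ?addn0 ?addn1// => i /negPf->.
move=> i; rewrite iterS -/a phij; have [->|ij] := eqVneq i j.
  by rewrite addn1/= phi_nd.
by rewrite addn0 (le_trans _ (phic i))// phi_le.
Qed.

Lemma max_fun_iter_cvg0 phi t : 0 < t ->
  (forall i, nonneg_fun (phi i)) ->
  (forall i, nondecreasing_on_nonneg (phi i)) ->
  (forall i t, 0 < t -> iter k (phi i) t @[k --> \oo] --> (0 : R)) ->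
  iter k (max_fun phi) t @[k --> \oo] --> (0 : R).
Proof.
move=> t0 phi0 phi_nd phi_cvg.
have phi_lt i s : 0 < s -> phi i s < s.
  exact: matkowski_lt (phi_nd i) (phi_cvg i).
have phi_le i s : 0 <= s -> phi i s <= s.
  rewrite le_eqVlt => /predU1P[<-|/phi_lt/ltW//].
  (* At [s = 0]: [phi i 0 <= phi i e < e] for every [e > 0]. *)
  apply/ler_addgt0Pr => e e0; rewrite add0r.
  exact: le_trans (phi_nd i _ _ (lexx 0) (ltW e0)) (ltW (phi_lt _ _ e0)).
apply/cvgrPdist_lt => e e0.
have : \forall M \near \oo, forall i, iter M (phi i) t < e.
  by apply: filter_forall => i; exact: cvgr_lt (phi_cvg i _ t0) _ e0.
case=> M _ /= phiM; exists (N'.+1 * M)%N => // k /= kM.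
rewrite sub0r normrN ger0_norm; last first.
  by apply: iter_ge0 (ltW t0); exact: max_fun_ge0.
have [c [ck phic]] := iter_max_fun_le k t0 phi0 phi_nd phi_le.
have [i Mci] : exists i, (M <= c i)%N.
  apply: contrapT => cM; move: kM; rewrite -ck leqNgt => /negP; apply.
  rewrite -[X in (_ < X * _)%N]card_ord -sum_nat_const.
  (* If all counts were below [M], their sum would be below [N'.+1 * M]; the [ord0] term supplies
     the strict inequality. *)
  rewrite (bigD1 ord0)//= [X in (_ < X)%N](bigD1 ord0)//= -addSn.
  have cltM i : (c i < M)%N by rewrite ltnNge; apply/negP => Mc; apply: cM; exists i.
  by apply: leq_add => //; apply: leq_sum => i _; exact: ltnW.
exact: le_lt_trans (phic i) (phiM _ Mci i).
Qed.

End comparison_functions.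

(** * Nearest points and the Hausdorff metric *)

Section hausdorff_metric.
Context {R : realType} {X : metricType R}.
Implicit Types (K L : compacts X) (A : set X) (x y : X).

Lemma mdist_continuous x : continuous (@mdist R X x).
Proof.
move=> y; apply/cvgrPdist_lt => e e0; apply/nbhs_ballP; exists e => //= z.
rewrite ballEmdist /=; apply: le_lt_trans.
rewrite ler_distlC; have := metric_triangle x y z; have := metric_triangle x z y.
by rewrite (metric_sym z y); lra.
Qed.

Lemma dist_to_attained K x :
  exists2 y, compact_set K y & mdist x y = dist_to (compact_set K) x.
Proof.
have [|y] := @compact_EVT_min X R (mdist x) _ (compacts_nonempty K) (@compacts_compact _ K).
  by apply: continuous_subspaceT; exact: mdist_continuous.
rewrite inE => Ky ymin; exists y => //; apply/eqP; rewrite eq_le dist_to_le// andbT.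
by apply: dist_to_ge => [|z Kz]; [exact: compacts_nonempty|apply: ymin; rewrite inE].
Qed.

Lemma hausdorff_dist_le K L r :
  (forall x, compact_set K x -> dist_to (compact_set L) x <= r) ->
  (forall y, compact_set L y -> dist_to (compact_set K) y <= r) ->
  mdist K L <= r.
Proof.
move=> Kr Lr; rewrite [mdist K L]/(hausdorff_dist K L) ge_max.
by rewrite !excess_le//; exact: compacts_nonempty.
Qed.

Lemma dist_to_le_mdist K L x : compact_set K x ->
  dist_to (compact_set L) x <= mdist K L.
Proof.
move=> Kx; rewrite [mdist K L]/(hausdorff_dist K L).
by rewrite le_max dist_to_le_excess.
Qed.

(** Attainment of the distance avoids any epsilon in the bound, so comparison functions that are
    merely monotone can be applied to it. *)
Lemma mdist_nearest K L x : compact_set K x ->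
  exists2 y, compact_set L y & mdist x y <= mdist K L.
Proof.
by move=> /(dist_to_le_mdist L); have [y Ly <-] := dist_to_attained L x; exists y.
Qed.

End hausdorff_metric.

(** * Inheritance of each contraction kind by the Hutchinson operator *)

Section hutchinson_operator.
Context {R : realType} {X : metricType R} {N' : nat}.
Variables (w : 'I_N'.+1 -> X -> X) (wc : forall i, continuous (w i)).
Implicit Types K L : compacts X.
Let F : compacts X -> compacts X := hutchinson wc.

Lemma hutchinson_mdist_le K L (r : R) :
  (forall i x y, mdist x y <= mdist K L -> mdist (w i x) (w i y) <= r) ->
  mdist (F K) (F L) <= r.
Proof.
(* Generalizing the pair lets one argument serve for both excesses. *)
have half K' L' : mdist K' L' = mdist K L ->
    (forall i x y, mdist x y <= mdist K L -> mdist (w i x) (w i y) <= r) ->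
    forall x, compact_set (F K') x -> dist_to (compact_set (F L')) x <= r.
  move=> KL wr _ [i _ [x Kx <-]].
  have [y Ly xy] := mdist_nearest L' Kx.
  apply: (@le_trans _ _ (mdist (w i x) (w i y))); last by apply: wr; rewrite -KL.
  by apply: dist_to_le; exists i => //; exists y.
move=> wr; apply: hausdorff_dist_le; first exact: half.
by apply: half => //; exact: metric_sym.
Qed.

Lemma hutchinson_phi_contraction (phi : 'I_N'.+1 -> R -> R) :
  (forall i, nondecreasing_on_nonneg (phi i)) ->
  (forall i, phi_contraction (phi i) (w i)) ->
  phi_contraction (max_fun phi) F.
Proof.
move=> phi_nd wphi; split=> [|K L]; first exact: max_fun_ge0.
apply: hutchinson_mdist_le => i x y xy.
apply: le_trans (le_max_fun phi i _); apply: le_trans ((wphi i).2 x y) _.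
exact: phi_nd (mdist_ge0 x y) xy.
Qed.

Lemma hutchinson_banach : (forall i, banach_contraction (w i)) ->
  banach_contraction F.
Proof.
move=> wB; have /choice[L wL] : forall i, exists L : R,
    0 <= L < 1 /\ forall x y, mdist (w i x) (w i y) <= L * mdist x y.
  by move=> i; have /banach_contractionP[L] := wB i; exists L.
(* The Lipschitz constants are viewed as constant functions; the argument [0] is arbitrary. *)
apply/banach_contractionP; exists (max_fun (fun i _ => L i) 0).
  by rewrite max_fun_ge0//= max_fun_lt// => i; have [/andP[]] := wL i.
move=> K K'; apply: hutchinson_mdist_le => i x y xy.
have [/andP[L0 _] wi] := wL i; apply: le_trans (wi x y) _.
by rewrite ler_pM ?mdist_ge0// (le_max_fun (fun i _ => L i)).
Qed.

(* [t |-> lambda t * t] need not be nondecreasing, hence the halving: points at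
   distance s <= t / 2 satisfy lambda s * s <= t / 2, and those at distance
   s > t / 2 satisfy lambda s <= lambda (t / 2). *)
Lemma hutchinson_rakotch : (forall i, rakotch_contraction (w i)) ->
  rakotch_contraction F.
Proof.
move=> /choice[lambda wl].
have half_ge0 (t : R) : 0 <= t -> 0 <= t / 2 by move=> t0; rewrite divr_ge0.
have half1 : (2^-1 : R) < 1 by rewrite invf_lt1// ltr1n.
pose l t : R := Num.max 2^-1 (max_fun lambda (t / 2)).
have l_ge0 t : 0 <= l t by rewrite le_max invr_ge0 ler0n.
exists l; split.
- move=> t t0; rewrite l_ge0 ge_max ltW//=; apply: bigmax_le => // i _.
  by have [/(_ _ (half_ge0 _ t0))/andP[]] := wl i.
- move=> s t s0 st; rewrite ge_max le_max lexx/= le_max; apply/orP; right.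
  apply: le_bigmax2 => i _; have [_ + _ _] := wl i; apply; first exact: half_ge0.
  by rewrite ler_pM2r.
- move=> t t0; rewrite gt_max half1/= max_fun_lt// => i.
  by have [_ _ + _] := wl i; apply; rewrite divr_gt0.
split=> [t t0|K L]; first by rewrite mulr_ge0.
apply: hutchinson_mdist_le => i x y xy; have [l01 l_ni _ [_ wi]] := wl i.
have D0 : 0 <= mdist K L by exact: mdist_ge0.
apply: le_trans (wi x y) _; have /andP[l0 l1] := l01 _ (mdist_ge0 x y).
have [xyD|Dxy] := leP (mdist x y) (mdist K L / 2).
  rewrite (@le_trans _ _ (mdist x y)) ?ler_piMl ?mdist_ge0//.
  by rewrite (le_trans xyD)// mulrC ler_wpM2r// le_max lexx.
rewrite ler_pM ?mdist_ge0// le_max; apply/orP; right.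
apply: le_trans (le_max_fun lambda i _).
by apply: l_ni (ltW Dxy); exact: half_ge0.
Qed.

Lemma hutchinson_browder : (forall i, browder_contraction (w i)) ->
  browder_contraction F.
Proof.
move=> /choice[phi wphi]; exists (max_fun phi).
have phi_nd i : nondecreasing_on_nonneg (phi i) by case: (wphi i).
have phi0 i : nonneg_fun (phi i) by have [_ _ _ []] := wphi i.
split.
- exact: max_fun_nondecreasing.
- move=> t t0; apply: max_fun_right_continuous => // i.
  by have [_ + _ _] := wphi i; apply.
- by move=> t t0; apply: max_fun_lt => // i; have [_ _ + _] := wphi i; apply.
- by apply: hutchinson_phi_contraction => // i; case: (wphi i).
Qed.

Lemma hutchinson_matkowski : (forall i, matkowski_contraction (w i)) ->
  matkowski_contraction F.
Proof.
move=> /choice[phi wphi]; exists (max_fun phi).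
have phi_nd i : nondecreasing_on_nonneg (phi i) by case: (wphi i).
have phi0 i : nonneg_fun (phi i) by have [_ _ []] := wphi i.
split.
- exact: max_fun_nondecreasing.
- by move=> t t0; apply: max_fun_iter_cvg0 => // i; case: (wphi i).
- by apply: hutchinson_phi_contraction => // i; case: (wphi i).
Qed.

Lemma hutchinson_contraction kind : (forall i, contraction_of kind (w i)) ->
  contraction_of kind F.
Proof.
case: kind => /=.
- exact: hutchinson_banach.
- exact: hutchinson_rakotch.
- exact: hutchinson_browder.
- exact: hutchinson_matkowski.
Qed.

End hutchinson_operator.

(** * Completeness of the space of compact sets *)

Section hyperspace_completeness.
Context {R : realType} {X : completeMetricType R}.

(* Total boundedness, with compact sets in place of finite ones. *)
Lemma ultra_near_compacts_cvg (U : set_system X) : UltraFilter U ->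
  (forall e : R, 0 < e -> exists K : compacts X,
    U [set x | exists2 k, compact_set K k & mdist x k < e]) ->
  exists p : X, U --> p.
Proof.
move=> UU Unear; suff : cvg U by exists (lim U).
apply: cauchy_cvg; apply: cauchy_exP => e e0.
have e20 : 0 < e / 2 by rewrite divr_gt0.
have [K UK] := Unear _ e20.
(* [p] sends each point to a nearby point of [K], or to itself if there is none. *)
have /choice[p pP] : forall x, exists k,
    (exists2 k, compact_set K k & mdist x k < e / 2) ->
    compact_set K k /\ mdist x k < e / 2.
  move=> x; have [[k Kk xk]|nk] :=
    pselect (exists2 k, compact_set K k & mdist x k < e / 2); first by exists k.
  by exists x => /nk.
have UpK : U (p @^-1` compact_set K) by apply: filterS UK => x /pP[Kpx _]; exact: Kpx.
(* The image of [U] under [p] clusters at some [k] in [K]; as [U] is an ultrafilter, [p] then stays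
   near [k] on a set of [U]. *)
have [k [_ kcl]] := @compacts_compact _ K (p @ U) _ UpK.
exists k; have [Uk|nUk] := in_ultra_setVsetC (p @^-1` ball k (e / 2)) UU.
  apply: filterS (filterI UK Uk) => x [/pP[_ xpx]]; rewrite /= !ballEmdist /= => kpx.
  rewrite [ltRHS]splitr (le_lt_trans (metric_triangle _ (p x) _))// ltrD//.
  by rewrite metric_sym.
by have [y []] := kcl _ _ (nUk : (p @ U) (~` ball k (e / 2))) (nbhsx_ballx k _ e20).
Qed.

Lemma compacts_cauchy_cvg (K : nat -> compacts X) : cauchy_ex (K @ \oo) ->
  exists L : compacts X, K @ \oo --> L.
Proof.
move=> Kcauchy.
have Kc e : 0 < e -> exists M, forall m n, (M <= m)%N -> (M <= n)%N ->
    mdist (K m) (K n) < e.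
  move=> e0; have [|L [M _ KL]] := Kcauchy (e / 2); first by rewrite divr_gt0.
  exists M => m n /KL + /KL; rewrite /= ballEmdist /= => Lm Ln.
  rewrite [ltRHS]splitr (le_lt_trans (metric_triangle _ L _))// ltrD//.
  by rewrite metric_sym.
pose T n := closure (\bigcup_(m in [set m | (n <= m)%N]) compact_set (K m)).
pose A := \bigcap_n T n.
have closedA : closed A by apply: closed_bigI => n _; exact: closed_closure.
(* A point of [A] is close to some late [K m], and [K m] is close to [K n] by the Cauchy
   property. *)
have nearA e : 0 < e -> exists M, forall n x, (M <= n)%N -> A x ->
    exists2 y, compact_set (K n) y & mdist x y < e.
  move=> e0; have e20 : 0 < e / 2 by rewrite divr_gt0.
  have [M KM] := Kc _ e20; exists M => n x Mn /(_ M I).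
  move=> /(_ _ (nbhsx_ballx x _ e20))[z [[m /= Mm Kz]]]; rewrite ballEmdist /= => xz.
  have [y Ky zy] := mdist_nearest (K n) Kz; exists y => //.
  rewrite [ltRHS]splitr (le_lt_trans (metric_triangle _ z _))// ltrD//.
  by rewrite (le_lt_trans zy)// KM.
have cvg_ultra (U : set_system X) : UltraFilter U ->
    (forall e, 0 < e -> exists n,
      U [set x | exists2 y, compact_set (K n) y & mdist x y < e]) ->
    exists p : X, U --> p.
  move=> UU Unear; apply: ultra_near_compacts_cvg => e /Unear[n Un].
  by exists (K n).
have compactA : compact A.
  rewrite compact_ultra => U UU UA.
  have [e e0|p Up] := cvg_ultra U UU.
    have [M AM] := nearA _ e0; exists M; apply: filterS UA => x.
    exact: AM (leqnn M).
  exists p; split => //; apply: closedA => B /Up UB.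
  by have [x [Ax Bx]] := filter_ex (filterI UA UB); exists x.
(* Choose [y m] in each late [K m] within [e] of [x]; the limit of an ultrafilter refining this
   sequence lies in every [T n'], hence in [A]. *)
have nearK e : 0 < e -> exists M, forall n x, (M <= n)%N -> compact_set (K n) x ->
    exists2 y, A y & mdist x y <= e.
  move=> e0; have [M KM] := Kc _ e0; exists M => n x Mn Kx.
  have /choice[y yP] : forall m, exists y, (M <= m)%N ->
      compact_set (K m) y /\ mdist x y < e.
    move=> m; have [y Ky xy] := mdist_nearest (K m) Kx.
    by exists y => Mm; split => //; rewrite (le_lt_trans xy)// KM.
  have [U [UU yU]] := ultraFilterLemma (fmap_proper_filter y eventually_filter).
  have [e' e'0|p Up] := cvg_ultra U UU.
    have [M' KM'] := Kc _ e'0; exists (maxn M M'); apply: yU.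
    exists (maxn M M') => // m /=; rewrite geq_max => /andP[Mm M'm].
    have [Ky _] := yP _ Mm.
    have [z Kz yz] := mdist_nearest (K (maxn M M')) Ky; exists z => //.
    by rewrite (le_lt_trans yz)// KM'// leq_maxr.
  exists p.
    move=> n' _ B /Up UB.
    have : U (\bigcup_(m in [set m | (n' <= m)%N]) compact_set (K m)).
      apply: yU; exists (maxn M n') => // m /=; rewrite geq_max => /andP[Mm nm].
      by exists m => //; have [] := yP _ Mm.
    by move=> /(filterI UB)/filter_ex[z [Bz Kz]]; exists z.
  apply/ler_addgt0Pr => d d0.
  have UM : U [set z | mdist x z < e].
    by apply: yU; exists M => // m /= /yP[].
  have [z [xz]] := filter_ex (filterI UM (Up _ (nbhsx_ballx p _ d0))).
  rewrite ballEmdist /= metric_sym => zp.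
  by rewrite (le_trans (metric_triangle _ z _))// lerD// ltW.
have A0 : A !=set0.
  have [M KM] := nearK 1 ltr01; have [x Kx] := compacts_nonempty (K M).
  by have [y Ay _] := KM M x (leqnn M) Kx; exists y.
have Aok : `[< A !=set0 /\ compact A >] by apply/asboolP.
exists (Compacts Aok); apply/cvg_mdistP => e e0.
have e20 : 0 < e / 2 by rewrite divr_gt0.
have [M1 AM] := nearA _ e20; have [M2 KM] := nearK _ e20.
exists (maxn M1 M2) => // n /=; rewrite geq_max => /andP[M1n M2n].
(* [hausdorff_dist_le] yields only a non-strict bound, so [e / 2] provides the strict one. *)
apply: (@le_lt_trans _ _ (e / 2)); last first.
  by rewrite gtr_pMr// invf_lt1// ltr1n.
apply: hausdorff_dist_le => x /=.
  by move=> /(AM _ _ M1n)[y Ky /ltW]; apply: le_trans; exact: dist_to_le.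
by move=> /(KM _ _ M2n)[y Ay]; apply: le_trans; exact: dist_to_le.
Qed.

End hyperspace_completeness.

(** * Existence and uniqueness of the attractor *)

Theorem theorem2p18 (R : realType) (X : completeMetricType R) (N' : nat)
    (w : 'I_N'.+1 -> X -> X) (kind : contraction_kind)
    (w_contr : forall i, contraction_of kind (w i)) :
  exists wc : forall i, continuous (w i),
    contraction_of kind (hutchinson wc : compacts X -> compacts X) /\
    exists A : compacts X,
      contractive_fixed_point (hutchinson wc) A /\
      forall B : compacts X, hutchinson wc B = B -> B = A.
Proof.
have wc i : continuous (w i).
  exact/weak_meir_keeler_continuous/contraction_weak_meir_keeler/w_contr.
have Fcontr := hutchinson_contraction wc w_contr.
exists wc; split=> //.
(* A singleton serves as the starting compact set of the iteration; this is where [X] is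
   nonempty. *)
have point_ok : `[< [set (point : X)] !=set0 /\ compact [set (point : X)] >].
  by apply/asboolP; split; [exists point|exact: compact_set1].
have [A Afix] := contractive_fixed_point_exists (Compacts point_ok)
  compacts_cauchy_cvg (contraction_weak_meir_keeler Fcontr)
  (contraction_orbits_asymptotic Fcontr).
by exists A; split=> // B; exact: contractive_fixed_point_unique.
Qed.
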